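(* Let $\varepsilon_0,\mu_0>0$ be constants. Let $\chi$ be any one of the following causal susceptibility kernels, with Laplace transform $\widehat\chi(s)$, $\operatorname{Re}s>0$: (a) (Debye) $\chi(t)=\beta e^{-\lambda t}$ with $\lambda,\beta>0$; (b) (delay) $\chi(t)=\alpha_1+\alpha_2\Theta(t-t_* )$, where $\Theta$ is the Heaviside function, $t_*>0$ and $\alpha_1\ge\alpha_2>0$; (c) (Drude) $\chi(t)=\frac{\omega_D^2}{\gamma_D}\bigl(1-e^{-\gamma_D t}\bigr)$ with collision frequency $\gamma_D>0$ and plasma frequency $\omega_D>0$; (d) (Lorentz) $\chi(t)=\frac{\beta_L}{\lambda_L}e^{-\frac{\alpha_L}{2}t}\sin(\lambda_L t)$, $\lambda_L=\sqrt{\omega_L^2-\frac{\alpha_L}{4}}$, with $0<\alpha_L<4\omega_L^2$ and $\beta_L>0$; (e) (fractional, Havriliak--Negami) the kernel whose Laplace transform is $\widehat\chi(s)=\dfrac{\gamma}{1+\beta s^{\eta}}$ with $\beta,\gamma>0$ and $0<\eta<2$ (principal branch of the power). Then $\varepsilon(s)=\varepsilon_0(1+\widehat\chi(s))$ satisfies the strong passivity condition $$\operatorname{Re}\bigl(\varepsilon(s)s\bigr)\ge \varepsilon_0\operatorname{Re}s\qquad\text{for all }\operatorname{Re}s>0,$$ and the bound: for every $\sigma>0$ there exists $M_\sigma<\infty$ such that $$|\varepsilon(s)|\le M_\sigma\,\varepsilon_0\qquad\text{for all } s \text{ with }\operatorname{Re}s\ge\sigma .$$ The same holds for $\mu(s)=\mu_0(1+\widehat\chi(s))$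 with $\mu_0$ in place of $\varepsilon_0$.
   Context: The kernel $\chi$ is supported on $t\ge 0$ and describes a retarded (dispersive) electromagnetic material law, e.g. polarization $\varepsilon_0\int_0^t\chi(t')\boldsymbol E(t-t')\,dt'$ for the electric field or magnetization $\mu_0\int_0^t\chi(t')\boldsymbol H(t-t')\,dt'$ for the magnetic field. The Laplace transform is $\widehat\chi(s)=\int_0^\infty e^{-st}\chi(t)\,dt$. *)

(* Defs.v *)
From Stdlib Require Export Reals.
From Coquelicot Require Export Coquelicot.
Open Scope R_scope.

Definition Cexp (z : C) : C := (exp (Re z) * cos (Im z), exp (Re z) * sin (Im z)).

(* Principal argument, with values in (-PI, PI]; meaningful for z <> 0. *)
Definition Carg (z : C) : R :=
  if Rle_dec 0 (Im z) then acos (Re z / Cmod z) else - acos (Re z / Cmod z).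

Definition Clog (z : C) : C := (ln (Cmod z), Carg z).

(* Principal branch of z^a, for z <> 0. *)
Definition Cpowr (z : C) (a : R) : C := Cexp (RtoC a * Clog z)%C.

Definition laplace_integrand (chi : R -> R) (s : C) (t : R) : C :=
  (Cexp (- (s * RtoC t)) * RtoC (chi t))%C.

(* Improper Riemann integral over (0, +oo).  The lower endpoint is also taken
   as a limit, because the Havriliak-Negami kernel with eta < 1 behaves like
   t^(eta - 1) at 0. *)
Definition is_laplace (chi : R -> R) (s l : C) : Prop :=
  is_RInt_gen (V := C_R_NormedModule) (laplace_integrand chi s)
    (at_right 0) (Rbar_locally p_infty) l.

Definition laplace (chi : R -> R) (s : C) : C :=
  RInt_gen (V := C_R_CompleteNormedModule) (laplace_integrand chi s)
    (at_right 0) (Rbar_locally p_infty).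

Definition Heaviside (t : R) : R := if Rle_dec 0 t then 1 else 0.

Definition causal (f : R -> R) (t : R) : R := if Rle_dec 0 t then f t else 0.

Inductive susceptibility_kernel : (R -> R) -> Prop :=
| Debye (beta lambda : R) :
    0 < lambda -> 0 < beta ->
    susceptibility_kernel (causal (fun t => beta * exp (- lambda * t)))
| Delay (alpha1 alpha2 tstar : R) :
    0 < tstar -> alpha1 >= alpha2 -> alpha2 > 0 ->
    susceptibility_kernel
      (causal (fun t => alpha1 + alpha2 * Heaviside (t - tstar)))
| Drude (omegaD gammaD : R) :
    0 < gammaD -> 0 < omegaD ->
    susceptibility_kernel
      (causal (fun t => omegaD ^ 2 / gammaD * (1 - exp (- gammaD * t))))
| Lorentz (alphaL betaL omegaL : R) :
    0 < alphaL -> alphaL < 4 * omegaL ^ 2 -> 0 < betaL ->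
    let lambdaL := sqrt (omegaL ^ 2 - alphaL / 4) in
    susceptibility_kernel
      (causal (fun t =>
         betaL / lambdaL * exp (- (alphaL / 2) * t) * sin (lambdaL * t)))
(* Havriliak-Negami: this kernel is specified by its Laplace transform. *)
| Fractional (beta gamma eta : R) (chi : R -> R) :
    0 < beta -> 0 < gamma -> 0 < eta < 2 ->
    (forall t, t < 0 -> chi t = 0) ->
    (forall s : C, 0 < Re s ->
       is_laplace chi s (RtoC gamma / (1 + RtoC beta * Cpowr s eta))%C) ->
    susceptibility_kernel chi.

(* epsilon(s) for a0 = epsilon_0, and mu(s) for a0 = mu_0 *)
Definition material (a0 : R) (chi : R -> R) (s : C) : C :=
  (RtoC a0 * (1 + laplace chi s))%C.

Definition strongly_passive (a0 : R) (a : C -> C) : Prop :=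
  forall s : C, 0 < Re s -> Re (a s * s)%C >= a0 * Re s.

Definition bounded_on_half_planes (a0 : R) (a : C -> C) : Prop :=
  forall sigma : R, 0 < sigma ->
    exists M : R, forall s : C, Re s >= sigma -> Cmod (a s) <= M * a0.

(* Main.v *)
(** Apart from the delay kernel, each transform has the form k / (s w(s)) with
    k > 0 and Re w > 0 on the right half plane: w = 1 + lambda/s (Debye),
    w = s + gamma (Drude), w = s + alpha + c/s (Lorentz),
    w = 1/s + beta s^(eta-1) (fractional; here |(eta-1) arg s| < PI/2 because
    |eta-1| < 1).  Then s times the transform is k/w, whose real part is
    positive, and the bound follows from a lower bound on |s| Re w(s).  For the
    delay kernel, s times the transform is alpha1 + alpha2 exp(-s tstar), with
    real part at least alpha1 - alpha2 >= 0. *)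
Require Import Defs.
From Stdlib Require Import Reals Lra.
From Coquelicot Require Import Coquelicot.
Open Scope R_scope.

(** * Improper integrals of complex exponentials *)

(** Subtraction is continuous, so the increment of [F] converges along the product filter. Every
    improper integral below thus reduces to two limits of one primitive. *)
Lemma is_RInt_gen_primitive {V : NormedModule R_AbsRing} (f F : R -> V)
    (Fa Fb : (R -> Prop) -> Prop) (la lb : V) :
  Filter Fa -> Filter Fb ->
  (forall a b, is_RInt f a b (minus (F b) (F a))) ->
  filterlim F Fa (locally la) -> filterlim F Fb (locally lb) ->
  is_RInt_gen f Fa Fb (minus lb la).
Proof.
intros FFa FFb Hf Ha Hb P HP.
assert (H : filterlim (fun ab : R * R => minus (F (snd ab)) (F (fst ab)))
              (filter_prod Fa Fb) (locally (minus lb la))).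
{ apply (filterlim_comp_2 (fun ab => F (snd ab)) (fun ab => opp (F (fst ab))) plus
      (G := locally lb) (H := locally (opp la))).
  - exact (filterlim_comp _ _ _ snd F _ _ _ filterlim_snd Hb).
  - refine (filterlim_comp _ _ _ (fun ab => F (fst ab)) opp _ _ _ _ (filterlim_opp la)).
    exact (filterlim_comp _ _ _ fst F _ _ _ filterlim_fst Ha).
  - apply filterlim_plus. }
generalize (H P HP); unfold filtermapi, filtermap.
apply filter_imp; intros ab Hab.
exists (minus (F (snd ab)) (F (fst ab))); split; auto.
Qed.

(** The fundamental theorem of calculus, applied to the real and imaginary parts separately. Keeping
    the factor [p] in the integrand avoids a division, so [p = 0] is allowed. *)
Lemma is_RInt_Cexp (k p : C) (a b : R) :
  is_RInt (V := C_R_NormedModule)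
    (fun t => k * p * Cexp (- (p * RtoC t)))%C a b
    (minus (- k * Cexp (- (p * RtoC b)))%C (- k * Cexp (- (p * RtoC a)))%C : C_R_NormedModule).
Proof.
destruct k as [k1 k2], p as [p1 p2].
apply (is_RInt_fct_extend_pair (U := R_NormedModule) (V := R_NormedModule)).
- evar_last.
  + apply (is_RInt_derive (V := R_CompleteNormedModule)
      (fun t => fst ((- (k1, k2)) * Cexp (- ((p1, p2) * RtoC t)))%C)).
    * intros x _; simpl; auto_derive; [exact I | simpl; unfold Rminus; ring].
    * intros x _; apply (ex_derive_continuous (V := R_NormedModule)); simpl; auto_derive; exact I.
  + reflexivity.
- evar_last.
  + apply (is_RInt_derive (V := R_CompleteNormedModule)
      (fun t => snd ((- (k1, k2)) * Cexp (- ((p1, p2) * RtoC t)))%C)).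
    * intros x _; simpl; auto_derive; [exact I | simpl; unfold Rminus; ring].
    * intros x _; apply (ex_derive_continuous (V := R_NormedModule)); simpl; auto_derive; exact I.
  + reflexivity.
Qed.

Lemma filterlim_C (F : (R -> Prop) -> Prop) (f : R -> C) (l : C) :
  Filter F ->
  filterlim (fun t => Re (f t)) F (locally (Re l)) ->
  filterlim (fun t => Im (f t)) F (locally (Im l)) ->
  filterlim f F (locally (l : C_R_NormedModule)).
Proof.
intros FF H1 H2.
apply filterlim_locally; intros eps.
generalize (proj1 (filterlim_locally _ _) H1 eps) (proj1 (filterlim_locally _ _) H2 eps).
intros A B; generalize (filter_and _ _ A B); apply filter_imp.
intros t [X Y]; split; assumption.
Qed.

Lemma continuous_mul_Cexp (k p : C) (x : R) :
  filterlim (fun t : R => k * Cexp (- (p * RtoC t)))%C (locally x)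
    (locally ((k * Cexp (- (p * RtoC x)))%C : C_R_NormedModule)).
Proof.
destruct k as [k1 k2], p as [p1 p2].
apply filterlim_C; [apply locally_filter | |].
- apply (ex_derive_continuous (V := R_NormedModule)); unfold Re; simpl; auto_derive; exact I.
- apply (ex_derive_continuous (V := R_NormedModule)); unfold Im; simpl; auto_derive; exact I.
Qed.

Lemma Cmod_Cexp (z : C) : Cmod (Cexp z) = exp (Re z).
Proof.
unfold Cmod, Cexp; simpl fst; simpl snd.
replace ((exp (Re z) * cos (Im z)) ^ 2 + (exp (Re z) * sin (Im z)) ^ 2)
  with (exp (Re z) ^ 2 * (Rsqr (sin (Im z)) + Rsqr (cos (Im z)))) by (unfold Rsqr; ring).
rewrite sin2_cos2, Rmult_1_r.
apply sqrt_pow2; left; apply exp_pos.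
Qed.

Lemma Cexp_plus (z w : C) : Cexp (z + w) = (Cexp z * Cexp w)%C.
Proof.
destruct z as [a b], w as [c d]; unfold Cexp, Cmult, Cplus, Re, Im; simpl.
rewrite exp_plus, cos_plus, sin_plus; f_equal; ring.
Qed.

(** The modulus is [|k| exp(- Re p * t)], which tends to 0 and squeezes both the real and the
    imaginary part. *)
Lemma mul_Cexp_vanishes (k p : C) :
  0 < Re p ->
  filterlim (fun t : R => k * Cexp (- (p * RtoC t)))%C (Rbar_locally p_infty)
    (locally (RtoC 0 : C_R_NormedModule)).
Proof.
intros Hp.
assert (H : is_lim (fun t => Cmod k * exp (- Re p * t)) p_infty 0).
{ evar_last.
  - apply is_lim_scal_l.
    apply (is_lim_comp exp (fun t => - Re p * t) p_infty 0 m_infty).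
    + apply is_lim_exp_m.
    + evar_last; [apply is_lim_scal_l, is_lim_id |].
      (* The product of [- Re p] with [p_infty] in [Rbar] is computed by a sign test. *)
      simpl. destruct (Rle_dec 0 (- Re p)); [exfalso; lra |]. reflexivity.
    (* Composition of limits asks that the inner function avoid its limit; a finite value never
       equals [m_infty]. *)
    + exists 0; intros; discriminate.
  - simpl; f_equal; ring. }
assert (B : forall g : C -> R, (forall z, Rabs (g z) <= Cmod z) ->
   is_lim (fun t => g (k * Cexp (- (p * RtoC t)))%C) p_infty 0).
{ intros g Hg.
  apply (is_lim_le_le_loc (fun t => - (Cmod k * exp (- Re p * t)))
           (fun t => Cmod k * exp (- Re p * t))).
  - exists 0; intros t _.
    generalize (Hg (k * Cexp (- (p * RtoC t)))%C).
    rewrite Cmod_mult, Cmod_Cexp.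
    replace (Re (- (p * RtoC t))%C) with (- Re p * t) by (unfold Re; simpl; ring).
    intros X; apply Rabs_le_between in X; lra.
  - evar_last; [apply (is_lim_opp _ _ 0); exact H | simpl; f_equal; ring].
  - exact H. }
apply filterlim_C; [apply Rbar_locally_filter | |].
- apply (B Re), re_le_Cmod.
- apply (B Im); intros z; exact (Rle_trans _ _ _ (Rmax_r _ _) (Rmax_Cmod z)).
Qed.

Lemma Cexp_0 : Cexp 0 = RtoC 1.
Proof. unfold Cexp, Re, Im; simpl; rewrite exp_0, cos_0, sin_0; unfold RtoC; f_equal; ring. Qed.

Lemma C_neq_0_Re (z : C) : 0 < Re z -> z <> RtoC 0.
Proof. intros H E; rewrite E in H; unfold Re in H; simpl in H; lra. Qed.

(** Common source of the three integrals that follow: from a point to infinity, from 0+ to infinity,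
    and from 0+ to a point. The primitive is divided by [p] here. *)
Lemma is_RInt_gen_Cexp (k p : C) (Fa Fb : (R -> Prop) -> Prop) (la lb : C) :
  p <> RtoC 0 -> Filter Fa -> Filter Fb ->
  filterlim (fun t => - (k / p) * Cexp (- (p * RtoC t)))%C Fa (locally (la : C_R_NormedModule)) ->
  filterlim (fun t => - (k / p) * Cexp (- (p * RtoC t)))%C Fb (locally (lb : C_R_NormedModule)) ->
  is_RInt_gen (V := C_R_NormedModule) (fun t => k * Cexp (- (p * RtoC t)))%C Fa Fb (lb - la)%C.
Proof.
intros Hp FFa FFb Ha Hb.
apply (is_RInt_gen_primitive (V := C_R_NormedModule) _ (fun t => - (k / p) * Cexp (- (p * RtoC t)))%C);
  auto.
intros a b.
apply (is_RInt_ext (V := C_R_NormedModule) (fun t => (k / p) * p * Cexp (- (p * RtoC t)))%C).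
- assert (E : forall u : C, (k / p * p * u = k * u)%C) by (intros u; field; exact Hp).
  intros t _; apply E.
- apply is_RInt_Cexp.
Qed.

Lemma is_RInt_gen_Cexp_from (k p : C) (a : R) :
  0 < Re p ->
  is_RInt_gen (V := C_R_NormedModule) (fun t => k * Cexp (- (p * RtoC t)))%C
    (at_point a) (Rbar_locally p_infty) (k / p * Cexp (- (p * RtoC a)))%C.
Proof.
intros Hp; pose proof (C_neq_0_Re p Hp) as Hp0.
evar_last.
- apply is_RInt_gen_Cexp; try exact _; try exact Hp0.
  + intros P HP; exact (locally_singleton _ _ HP).
  + apply mul_Cexp_vanishes; exact Hp.
- unfold Cminus; ring.
Qed.

Lemma mul_Cexp_at_right_0 (k p : C) :
  filterlim (fun t : R => k * Cexp (- (p * RtoC t)))%C (at_right 0)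
    (locally (k : C_R_NormedModule)).
Proof.
intros P HP.
apply (filter_le_within (F := locally 0)), (continuous_mul_Cexp k p 0).
rewrite Cmult_0_r, Copp_0, Cexp_0, Cmult_1_r; exact HP.
Qed.

Lemma is_RInt_gen_Cexp_0 (k p : C) :
  0 < Re p ->
  is_RInt_gen (V := C_R_NormedModule) (fun t => k * Cexp (- (p * RtoC t)))%C
    (at_right 0) (Rbar_locally p_infty) (k / p)%C.
Proof.
intros Hp; pose proof (C_neq_0_Re p Hp) as Hp0.
evar_last.
- apply is_RInt_gen_Cexp; try exact _; try exact Hp0.
  + apply mul_Cexp_at_right_0.
  + apply mul_Cexp_vanishes; exact Hp.
- unfold Cminus; ring.
Qed.

Lemma is_RInt_gen_Cexp_upto (k p : C) (b : R) :
  p <> RtoC 0 ->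
  is_RInt_gen (V := C_R_NormedModule) (fun t => k * Cexp (- (p * RtoC t)))%C
    (at_right 0) (at_point b) (k / p * (1 - Cexp (- (p * RtoC b))))%C.
Proof.
intros Hp0.
evar_last.
- apply is_RInt_gen_Cexp; try exact _; try exact Hp0.
  + apply mul_Cexp_at_right_0.
  + intros P HP; exact (locally_singleton _ _ HP).
- unfold Cminus; ring.
Qed.

(** Both endpoints are eventually positive, so the integrand is only seen at [t > 0], where the
    cutoff in [causal] disappears. *)
Lemma is_RInt_gen_ext_pos (f g : R -> C) (l : C) :
  (forall t, 0 < t -> f t = g t) ->
  is_RInt_gen (V := C_R_NormedModule) f (at_right 0) (Rbar_locally p_infty) l ->
  is_RInt_gen (V := C_R_NormedModule) g (at_right 0) (Rbar_locally p_infty) l.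
Proof.
intros H; apply is_RInt_gen_ext; try exact _.
apply (Filter_prod _ _ _ (fun a => 0 < a) (fun b => 0 < b)).
- exists (mkposreal 1 Rlt_0_1); intros y _ Hy; exact Hy.
- exists 0; auto.
- intros a b Ha Hb x [Hx _]; apply H; simpl in Hx.
  apply Rlt_trans with (2 := Hx), Rmin_glb_lt; assumption.
Qed.

(** * Laplace transforms of the explicit kernels *)

Lemma Cexp_RtoC (x : R) : Cexp (RtoC x) = RtoC (exp x).
Proof. unfold Cexp, RtoC, Re, Im; simpl; rewrite cos_0, sin_0; f_equal; ring. Qed.

Lemma is_laplace_Debye (beta lambda : R) (s : C) :
  0 < Re s -> 0 < lambda ->
  is_laplace (causal (fun t => beta * exp (- lambda * t))) s
    (RtoC beta / (s + RtoC lambda))%C.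
Proof.
intros Hs Hl; unfold is_laplace.
apply is_RInt_gen_ext_pos with (2 := is_RInt_gen_Cexp_0 (RtoC beta) (s + RtoC lambda)
  ltac:(rewrite re_plus, re_RtoC; lra)).
intros t Ht; unfold laplace_integrand, causal.
destruct (Rle_dec 0 t); [| lra].
rewrite RtoC_mult, <- Cexp_RtoC.
replace (- ((s + RtoC lambda) * RtoC t))%C with (- (s * RtoC t) + RtoC (- lambda * t))%C
  by (rewrite RtoC_mult, RtoC_opp; ring).
rewrite Cexp_plus; ring.
Qed.

Lemma is_laplace_Delay (alpha1 alpha2 tstar : R) (s : C) :
  0 < Re s -> 0 < tstar ->
  is_laplace (causal (fun t => alpha1 + alpha2 * Heaviside (t - tstar))) s
    ((RtoC alpha1 + RtoC alpha2 * Cexp (- (s * RtoC tstar))) / s)%C.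
Proof.
intros Hs Ht; pose proof (C_neq_0_Re s Hs) as Hs0; unfold is_laplace.
evar_last.
(* The kernel is constant on each side of the jump at [tstar], so the integral is split there. *)
- apply (is_RInt_gen_Chasles (V := C_R_NormedModule)) with tstar; try exact _.
  + refine (is_RInt_gen_ext _ _ _ _ (is_RInt_gen_Cexp_upto (RtoC alpha1) s tstar Hs0)).
    apply (Filter_prod _ _ _ (fun a => 0 < a < tstar) (fun b => b = tstar)).
    * exists (mkposreal tstar Ht); intros y Hy Hy0; split; [exact Hy0 |].
      unfold ball in Hy; simpl in Hy; unfold AbsRing_ball, abs, minus, plus, opp in Hy; simpl in Hy.
      apply Rabs_lt_between in Hy; lra.
    * reflexivity.
    (* Integrands are compared strictly between the endpoints, so [x < tstar] and the Heaviside term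
       is 0. *)
    * intros a b Ha -> x; simpl; rewrite Rmin_left, Rmax_right by lra; intros Hx.
      unfold laplace_integrand, causal, Heaviside.
      destruct (Rle_dec 0 x); [| lra]; destruct (Rle_dec 0 (x - tstar)); [lra |].
      rewrite Rmult_0_r, Rplus_0_r; apply Cmult_comm.
  + refine (is_RInt_gen_ext _ _ _ _ (is_RInt_gen_Cexp_from (RtoC (alpha1 + alpha2)) s tstar Hs)).
    apply (Filter_prod _ _ _ (fun a => a = tstar) (fun b => tstar < b)).
    * reflexivity.
    * exists tstar; auto.
    * intros a b -> Hb x; simpl; rewrite Rmin_left, Rmax_right by lra; intros Hx.
      unfold laplace_integrand, causal, Heaviside.
      destruct (Rle_dec 0 x); [| lra]; destruct (Rle_dec 0 (x - tstar)); [| lra].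
      rewrite Rmult_1_r; apply Cmult_comm.
- rewrite RtoC_plus.
  (* The module addition is unfolded to complex addition so that [field] recognises it. *)
  match goal with |- plus ?a ?b = ?c => change ((a + b)%C = c :> C) end.
  field; exact Hs0.
Qed.

(** The transform is [k/s - k/(s + gammaD)] with [k * gammaD = omegaD^2], combined over a common
    denominator. *)
Lemma is_laplace_Drude (omegaD gammaD : R) (s : C) :
  0 < Re s -> 0 < gammaD ->
  is_laplace (causal (fun t => omegaD ^ 2 / gammaD * (1 - exp (- gammaD * t)))) s
    (RtoC (omegaD ^ 2) / (s * (s + RtoC gammaD)))%C.
Proof.
intros Hs Hg; pose proof (C_neq_0_Re s Hs) as Hs0; unfold is_laplace.
assert (Hsg : 0 < Re (s + RtoC gammaD)) by (rewrite re_plus, re_RtoC; lra).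
pose proof (C_neq_0_Re _ Hsg) as Hsg0.
assert (Hg0 : RtoC gammaD <> RtoC 0) by (intros E; apply RtoC_inj in E; lra).
set (k := RtoC (omegaD ^ 2 / gammaD)).
evar_last.
- refine (is_RInt_gen_ext_pos _ _ _ _
    (is_RInt_gen_plus _ _ _ _ (is_RInt_gen_Cexp_0 k s Hs)
       (is_RInt_gen_Cexp_0 (- k) (s + RtoC gammaD) Hsg))).
  intros t Ht; unfold laplace_integrand, causal.
  destruct (Rle_dec 0 t); [| lra].
  rewrite RtoC_mult, RtoC_minus, <- (Cexp_RtoC (- gammaD * t)).
  replace (- ((s + RtoC gammaD) * RtoC t))%C with (- (s * RtoC t) + RtoC (- gammaD * t))%C
    by (rewrite RtoC_mult, RtoC_opp; ring).
  rewrite Cexp_plus; fold k.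
  match goal with |- plus ?a ?b = ?c => change ((a + b)%C = c :> C) end.
  ring.
- match goal with |- plus ?a ?b = ?c => change ((a + b)%C = c :> C) end.
  unfold k; rewrite RtoC_div by lra.
  field; auto.
Qed.

Lemma Ci_sqr : (Ci * Ci = - (1))%C.
Proof. unfold Ci, Cmult, RtoC, Copp; simpl; f_equal; ring. Qed.

Lemma Cexp_minus_Ci (x : R) :
  (Cexp (Ci * RtoC x) - Cexp (- (Ci * RtoC x)) = RtoC 2 * Ci * RtoC (sin x))%C.
Proof.
unfold Cexp, Ci, RtoC, Cminus, Cplus, Copp, Cmult, Re, Im; simpl.
replace (0 * x - 1 * 0) with 0 by ring; replace (0 * 0 + 1 * x) with x by ring.
rewrite Ropp_0, exp_0, cos_neg, sin_neg; f_equal; ring.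
Qed.

(** By Euler's formula the sine is a difference of two exponentials, giving decay rates [p] and [q]
    equal to [s + a] minus or plus [i lambda]; their product is the denominator. *)
Lemma is_laplace_damped_sin (beta a lambda : R) (s : C) :
  0 < Re s -> 0 < a -> lambda <> 0 ->
  is_laplace (causal (fun t => beta / lambda * exp (- a * t) * sin (lambda * t))) s
    (RtoC beta / ((s + RtoC a) * (s + RtoC a) + RtoC lambda * RtoC lambda))%C.
Proof.
intros Hs Ha Hl; unfold is_laplace.
set (p := (s + RtoC a - Ci * RtoC lambda)%C).
set (q := (s + RtoC a + Ci * RtoC lambda)%C).
assert (Hp : 0 < Re p) by (unfold p, Re, Im in *; simpl; lra).
assert (Hq : 0 < Re q) by (unfold q, Re, Im in *; simpl; lra).
pose proof (C_neq_0_Re _ Hp) as Hp0; pose proof (C_neq_0_Re _ Hq) as Hq0.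
assert (Hl0 : RtoC lambda <> RtoC 0) by (intros E; apply RtoC_inj in E; lra).
assert (H2 : RtoC 2 <> RtoC 0) by (intros E; apply RtoC_inj in E; lra).
assert (Hi : Ci <> RtoC 0) by (intros E; injection E; lra).
(* The amplitude [beta / lambda] divided by the [2i] of Euler's formula. *)
set (c := (RtoC (beta / lambda) / (RtoC 2 * Ci))%C).
evar_last.
- refine (is_RInt_gen_ext_pos _ _ _ _
    (is_RInt_gen_plus _ _ _ _ (is_RInt_gen_Cexp_0 c p Hp) (is_RInt_gen_Cexp_0 (- c) q Hq))).
  intros t Ht; unfold laplace_integrand, causal.
  destruct (Rle_dec 0 t); [| lra].
  replace (- (p * RtoC t))%C
    with (- (s * RtoC t) + RtoC (- a * t) + Ci * RtoC (lambda * t))%C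
    by (unfold p; rewrite !RtoC_mult, RtoC_opp; ring).
  replace (- (q * RtoC t))%C
    with (- (s * RtoC t) + RtoC (- a * t) + - (Ci * RtoC (lambda * t)))%C
    by (unfold q; rewrite !RtoC_mult, RtoC_opp; ring).
  rewrite !Cexp_plus, Cexp_RtoC, (RtoC_mult _ (sin _)), (RtoC_mult (beta / lambda)).
  match goal with |- plus ?u ?v = ?w => change ((u + v)%C = w :> C) end.
  set (E := Cexp (- (s * RtoC t))); set (D := RtoC (exp (- a * t))).
  transitivity (c * E * D * (Cexp (Ci * RtoC (lambda * t)) - Cexp (- (Ci * RtoC (lambda * t)))))%C;
    [ring |].
  rewrite Cexp_minus_Ci; unfold c; field; auto.
- match goal with |- plus ?u ?v = ?w => change ((u + v)%C = w :> C) end.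
  replace ((s + RtoC a) * (s + RtoC a) + RtoC lambda * RtoC lambda)%C with (p * q)%C.
  2: { transitivity ((s + RtoC a) * (s + RtoC a) - Ci * Ci * (RtoC lambda * RtoC lambda))%C;
       [unfold p, q; ring | rewrite Ci_sqr; ring]. }
  (* Partial fractions read backwards: [c/p - c/q], where [q - p = 2 i lambda] cancels the
     denominator of [c]. *)
  transitivity (c * (q - p) / (p * q))%C; [field; auto |].
  replace (q - p)%C with (RtoC 2 * Ci * RtoC lambda)%C
    by (unfold p, q; replace (RtoC 2) with (1 + 1)%C by (rewrite <- RtoC_plus; f_equal; ring); ring).
  unfold c; rewrite RtoC_div by assumption; field; auto.
Qed.

(** * The principal branch on the right half plane *)

(** The arccosine recovers the real part and only the absolute value of the imaginary part; the sign
    case in [Carg] restores the rest. *)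
Lemma Cexp_Clog (s : C) : s <> RtoC 0 -> Cexp (Clog s) = s.
Proof.
intros Hs; pose proof (Cmod_gt_0 s) as [HC _]; specialize (HC Hs).
destruct s as [x y].
set (m := Cmod (x, y)) in *.
assert (Hm : x * x + y * y = m * m).
{ unfold m, Cmod; simpl; rewrite sqrt_sqrt; nra. }
assert (Hu : - 1 <= x / m <= 1).
{ apply Rabs_le_between; unfold Rdiv; rewrite Rabs_mult, Rabs_inv, (Rabs_pos_eq m) by lra.
  apply Rmult_le_reg_r with m; [exact HC |]; field_simplify; [| lra].
  apply (re_le_Cmod (x, y)). }
assert (Hsin : sin (acos (x / m)) = Rabs y / m).
{ rewrite sin_acos by exact Hu.
  replace (1 - (x / m) ²) with ((Rabs y / m) ^ 2).
  - apply sqrt_pow2; apply Rdiv_le_0_compat; [apply Rabs_pos | exact HC].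
  - unfold Rdiv; rewrite Rpow_mult_distr, pow2_abs; unfold Rsqr.
    replace (y ^ 2) with (m * m - x * x) by (rewrite <- Hm; ring); field; lra. }
unfold Cexp, Clog, Carg; fold m; unfold Re, Im; simpl.
rewrite exp_ln by exact HC.
destruct (Rle_dec 0 y).
- rewrite cos_acos, Hsin, Rabs_pos_eq by assumption; f_equal; field; lra.
- rewrite cos_neg, sin_neg, cos_acos, Hsin, Rabs_left by lra; f_equal; field; lra.
Qed.

Lemma Carg_right_half_plane (s : C) : 0 < Re s -> Rabs (Carg s) <= PI / 2.
Proof.
intros Hs; pose proof (C_neq_0_Re s Hs) as Hs0.
pose proof (proj1 (Cmod_gt_0 s) Hs0) as HC.
assert (Hu : 0 < Re s / Cmod s) by (apply Rdiv_lt_0_compat; assumption).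
assert (Hu1 : Re s / Cmod s <= 1).
{ apply Rmult_le_reg_r with (Cmod s); [exact HC |]; field_simplify; [| lra].
  pose proof (re_le_Cmod s); pose proof (Rle_abs (Re s)); lra. }
assert (Ha : Rabs (acos (Re s / Cmod s)) <= PI / 2).
{ pose proof (acos_bound (Re s / Cmod s)) as [A B].
  rewrite Rabs_pos_eq by exact A.
  (* An arccosine above [PI / 2] would have negative cosine, yet its cosine is
     [Re s / Cmod s > 0]. *)
  apply Rnot_lt_le; intros H.
  pose proof (cos_lt_0 _ H ltac:(pose proof PI_RGT_0; lra)) as X.
  rewrite cos_acos in X by lra; lra. }
unfold Carg; destruct (Rle_dec 0 (Im s)); [exact Ha |].
rewrite Rabs_Ropp; exact Ha.
Qed.

(** Writing [s] as [Cexp (Clog s)] turns the quotient into the principal power with exponent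
    [eta - 1], whose polar form gives the real part. *)
Lemma Re_Cpowr_div (s : C) (eta : R) :
  s <> RtoC 0 ->
  Re (Cpowr s eta / s) = exp ((eta - 1) * ln (Cmod s)) * cos ((eta - 1) * Carg s).
Proof.
intros Hs.
assert (H : (Cpowr s eta / s = Cexp (RtoC (eta - 1) * Clog s))%C).
{ replace (Cpowr s eta) with (Cexp (RtoC (eta - 1) * Clog s) * s)%C.
  - field; exact Hs.
  - rewrite <- (Cexp_Clog s Hs) at 2.
    rewrite <- Cexp_plus; unfold Cpowr; f_equal.
    rewrite RtoC_minus; ring. }
rewrite H; unfold Cexp, Clog, Re, Im; simpl; f_equal; f_equal; ring.
Qed.

(** * Criteria for passivity and boundedness *)

(** Since [(1 + h) s = s + h s], passivity only asks that [h s] have nonnegative real part, and a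
    bound [M] on [h] becomes [1 + M]. *)
Lemma material_passive_bounded (a0 : R) (chi : R -> R) (h : C -> C) :
  0 < a0 ->
  (forall s, 0 < Re s -> is_laplace chi s (h s)) ->
  (forall s, 0 < Re s -> 0 <= Re (h s * s)) ->
  (forall sigma, 0 < sigma -> exists M, forall s, sigma <= Re s -> Cmod (h s) <= M) ->
  strongly_passive a0 (material a0 chi) /\ bounded_on_half_planes a0 (material a0 chi).
Proof.
intros Ha Hh Hp Hb.
assert (E : forall s, 0 < Re s -> laplace chi s = h s).
{ intros s Hs; exact (is_RInt_gen_unique (V := C_R_CompleteNormedModule) _ _ (Hh s Hs)). }
split.
- intros s Hs; unfold material; rewrite E by exact Hs.
  replace (RtoC a0 * (1 + h s) * s)%C with (RtoC a0 * (s + h s * s))%C by ring.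
  specialize (Hp s Hs); rewrite re_scal_l, re_plus.
  apply Rle_ge, Rmult_le_compat_l; lra.
- intros sigma Hsig; destruct (Hb sigma Hsig) as [M HM].
  exists (1 + M); intros s Hs; unfold material; rewrite E by lra.
  rewrite Cmod_mult, Cmod_R, Rabs_pos_eq, Rmult_comm by lra.
  apply Rmult_le_compat_r; [lra |].
  apply Rle_trans with (1 := Cmod_triangle _ _); rewrite Cmod_1.
  specialize (HM s ltac:(lra)); lra.
Qed.

Lemma Re_Cinv_pos (w : C) : 0 < Re w -> 0 < Re (/ w).
Proof.
destruct w as [x y]; unfold Re; simpl; intros Hx.
apply Rdiv_lt_0_compat; nra.
Qed.

(** Inversion preserves the right half plane, which gives passivity; [Re w <= |w|] bounds the
    transform by [k / m]. *)
Lemma material_of_positive_denominator (a0 k : R) (chi : R -> R) (w : C -> C) :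
  0 < a0 -> 0 < k ->
  (forall s, 0 < Re s -> is_laplace chi s (RtoC k / (s * w s))%C) ->
  (forall s, 0 < Re s -> 0 < Re (w s)) ->
  (forall sigma, 0 < sigma ->
     exists m, 0 < m /\ forall s, sigma <= Re s -> m <= Cmod s * Re (w s)) ->
  strongly_passive a0 (material a0 chi) /\ bounded_on_half_planes a0 (material a0 chi).
Proof.
intros Ha Hk Hl Hw Hm.
apply (material_passive_bounded a0 chi _ Ha Hl).
- intros s Hs.
  pose proof (C_neq_0_Re _ Hs); pose proof (C_neq_0_Re _ (Hw s Hs)).
  replace (RtoC k / (s * w s) * s)%C with (RtoC k * / w s)%C by (field; auto).
  rewrite re_scal_l.
  apply Rmult_le_pos; [lra | left; apply Re_Cinv_pos, Hw, Hs].
- intros sigma Hsig; destruct (Hm sigma Hsig) as [m [Hm0 Hms]].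
  exists (k / m); intros s Hs; specialize (Hms s Hs).
  assert (Hs' : 0 < Re s) by lra.
  pose proof (C_neq_0_Re _ Hs'); pose proof (C_neq_0_Re _ (Hw s Hs')).
  rewrite Cmod_div, Cmod_mult, Cmod_R, Rabs_pos_eq by (try apply Cmult_neq_0; auto; lra).
  apply Rmult_le_compat_l; [lra |]; apply Rinv_le_contravar; [exact Hm0 |].
  apply Rle_trans with (1 := Hms), Rmult_le_compat_l; [apply Cmod_ge_0 |].
  apply Rle_trans with (1 := Rle_abs _), re_le_Cmod.
Qed.

(** * Verification for the five kernels *)

Lemma material_susceptibility (a0 : R) (chi : R -> R) :
  0 < a0 -> susceptibility_kernel chi ->
  strongly_passive a0 (material a0 chi) /\ bounded_on_half_planes a0 (material a0 chi).
Proof.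
intros Ha Hchi.
assert (Hre : forall s, Re s <= Cmod s).
{ intros s; apply Rle_trans with (1 := Rle_abs _), re_le_Cmod. }
destruct Hchi as [beta lambda Hl Hb | alpha1 alpha2 tstar Ht H12 H2 | omegaD gammaD Hg Ho
  | alphaL betaL omegaL Hal Hal4 Hbl lambdaL | beta gamma eta chi Hb Hg [He1 He2] _ Hl].
- assert (Hw : forall s, 0 < Re s -> 1 <= Re (1 + RtoC lambda * / s)).
  { intros s Hs; rewrite re_plus, re_scal_l, re_RtoC.
    pose proof (Rmult_lt_0_compat _ _ Hl (Re_Cinv_pos s Hs)); lra. }
  apply (material_of_positive_denominator a0 beta _ (fun s => 1 + RtoC lambda * / s)%C Ha Hb).
  + intros s Hs; pose proof (C_neq_0_Re _ Hs).
    replace (s * (1 + RtoC lambda * / s))%C with (s + RtoC lambda)%C by (field; auto).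
    apply is_laplace_Debye; assumption.
  + intros s Hs; specialize (Hw s Hs); lra.
  (* Here [|s| >= sigma] and [Re w >= 1]. *)
  + intros sigma Hsig; exists sigma; split; [exact Hsig |]; intros s Hs.
    specialize (Hw s ltac:(lra)); specialize (Hre s); nra.
- assert (HE : forall s, 0 < Re s -> Cmod (Cexp (- (s * RtoC tstar))) <= 1).
  { intros s Hs; rewrite Cmod_Cexp, <- exp_0; left; apply exp_increasing.
    unfold Re in *; simpl; nra. }
  apply (material_passive_bounded a0 _
    (fun s => (RtoC alpha1 + RtoC alpha2 * Cexp (- (s * RtoC tstar))) / s)%C Ha).
  + intros s Hs; apply is_laplace_Delay; assumption.
  + intros s Hs; specialize (HE s Hs); pose proof (C_neq_0_Re _ Hs).
    set (E := Cexp (- (s * RtoC tstar))) in *.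
    replace ((RtoC alpha1 + RtoC alpha2 * E) / s * s)%C
      with (RtoC alpha1 + RtoC alpha2 * E)%C by (field; auto).
    rewrite re_plus, re_scal_l, re_RtoC.
    pose proof (re_le_Cmod E) as X; apply Rabs_le_between in X; nra.
  (* The numerator has modulus at most [alpha1 + alpha2], and [|s| >= sigma]. *)
  + intros sigma Hsig; exists ((alpha1 + alpha2) / sigma); intros s Hs.
    assert (Hs' : 0 < Re s) by lra; specialize (HE s Hs'); pose proof (C_neq_0_Re _ Hs').
    rewrite Cmod_div by auto.
    apply Rmult_le_compat; [apply Cmod_ge_0 | left; apply Rinv_0_lt_compat, Cmod_gt_0; auto | |].
    * apply Rle_trans with (1 := Cmod_triangle _ _).
      rewrite Cmod_mult, !Cmod_R, !Rabs_pos_eq by lra; nra.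
    * apply Rinv_le_contravar; [exact Hsig | specialize (Hre s); lra].
- apply (material_of_positive_denominator a0 (omegaD ^ 2) _ (fun s => s + RtoC gammaD)%C Ha).
  + nra.
  + intros s Hs; apply is_laplace_Drude; assumption.
  + intros s Hs; rewrite re_plus, re_RtoC; lra.
  (* Both [|s|] and [Re w] are at least [sigma]. *)
  + intros sigma Hsig; exists (sigma * sigma); split; [nra |]; intros s Hs.
    rewrite re_plus, re_RtoC; specialize (Hre s); nra.
- assert (Hlam : 0 < lambdaL) by (apply sqrt_lt_R0; lra).
  (* The constant term of [(s + alphaL/2)^2 + lambdaL^2 = s^2 + alphaL s + c]. *)
  set (c := (alphaL / 2) ^ 2 + lambdaL ^ 2).
  assert (Hc : 0 < c) by (unfold c; nra).
  assert (Hw : forall s, 0 < Re s -> Re s <= Re (s + RtoC alphaL + RtoC c * / s)).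
  { intros s Hs; rewrite !re_plus, re_scal_l, re_RtoC.
    pose proof (Rmult_lt_0_compat _ _ Hc (Re_Cinv_pos s Hs)); lra. }
  apply (material_of_positive_denominator a0 betaL _
    (fun s => s + RtoC alphaL + RtoC c * / s)%C Ha Hbl).
  + intros s Hs; pose proof (C_neq_0_Re _ Hs).
    replace (s * (s + RtoC alphaL + RtoC c * / s))%C
      with ((s + RtoC (alphaL / 2)) * (s + RtoC (alphaL / 2)) + RtoC lambdaL * RtoC lambdaL)%C.
    * apply is_laplace_damped_sin; lra.
    * replace (RtoC alphaL) with (RtoC (alphaL / 2) + RtoC (alphaL / 2))%C
        by (rewrite <- RtoC_plus; f_equal; field).
      unfold c; rewrite RtoC_plus, !RtoC_pow; field; auto.
  + intros s Hs; specialize (Hw s Hs); lra.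
  + intros sigma Hsig; exists (sigma * sigma); split; [nra |]; intros s Hs.
    specialize (Hw s ltac:(lra)); specialize (Hre s); nra.
(* The least value of [cos((eta - 1) theta)] for [|theta| <= PI/2]. *)
- set (d := cos (Rabs (eta - 1) * (PI / 2))).
  assert (Habs : Rabs (eta - 1) < 1) by (apply Rabs_lt_between; lra).
  pose proof PI_RGT_0 as HPI; pose proof (Rabs_pos (eta - 1)) as Habs0.
  assert (Hd : 0 < d) by (apply cos_gt_0; nra).
  (* The positive term [Re (1/s)] is dropped, leaving a lower bound [beta d |s|^(eta-1)]. *)
  assert (Hw : forall s, 0 < Re s ->
            beta * (exp ((eta - 1) * ln (Cmod s)) * d) <= Re (/ s + RtoC beta * (Cpowr s eta / s))).
  { intros s Hs; pose proof (C_neq_0_Re _ Hs) as Hs0.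
    rewrite re_plus, re_scal_l, Re_Cpowr_div by exact Hs0.
    pose proof (Re_Cinv_pos s Hs).
    assert (Hcos : d <= cos ((eta - 1) * Carg s)).
    (* Evenness moves the angle into [[0, PI]], where cosine decreases. *)
    { replace (cos ((eta - 1) * Carg s)) with (cos (Rabs (eta - 1) * Rabs (Carg s))).
      - pose proof (Carg_right_half_plane s Hs); pose proof (Rabs_pos (Carg s)).
        apply cos_decr_1; nra.
      - rewrite <- Rabs_mult; unfold Rabs at 1; destruct Rcase_abs; [apply cos_neg | reflexivity]. }
    pose proof (exp_pos ((eta - 1) * ln (Cmod s))).
    apply Rle_trans with (beta * (exp ((eta - 1) * ln (Cmod s)) * cos ((eta - 1) * Carg s)));
      [| lra].
    repeat (apply Rmult_le_compat_l; [lra |]); exact Hcos. }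
  apply (material_of_positive_denominator a0 gamma _
    (fun s => / s + RtoC beta * (Cpowr s eta / s))%C Ha Hg).
  + intros s Hs; pose proof (C_neq_0_Re _ Hs).
    replace (s * (/ s + RtoC beta * (Cpowr s eta / s)))%C
      with (1 + RtoC beta * Cpowr s eta)%C by (field; auto).
    apply Hl, Hs.
  + intros s Hs; apply Rlt_le_trans with (2 := Hw s Hs).
    repeat apply Rmult_lt_0_compat; auto using exp_pos.
  (* Multiplying the bound on [Re w] by [|s|] gives [beta d |s|^eta], which increases with [|s|]
     because [eta > 0]; the witness is its value at [|s| = sigma]. *)
  + intros sigma Hsig; exists (beta * d * exp (eta * ln sigma)); split.
    { repeat apply Rmult_lt_0_compat; auto using exp_pos. }
    intros s Hs; specialize (Hre s).
    apply Rle_trans with (2 := Rmult_le_compat_l _ _ _ (Cmod_ge_0 s) (Hw s ltac:(lra))).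
    replace (Cmod s * (beta * (exp ((eta - 1) * ln (Cmod s)) * d)))
      with (beta * d * exp (eta * ln (Cmod s))).
    2: { rewrite <- (exp_ln (Cmod s)) at 2 by lra.
         replace (eta * ln (Cmod s)) with (ln (Cmod s) + (eta - 1) * ln (Cmod s)) by ring.
         rewrite exp_plus; ring. }
    apply Rmult_le_compat_l; [nra |].
    (* Equality is split off because the monotonicity lemmas for [exp] and [ln] are strict. *)
    destruct (Rle_lt_or_eq_dec sigma (Cmod s) ltac:(lra)) as [Hlt | <-]; [| lra].
    left; apply exp_increasing, Rmult_lt_compat_l, ln_increasing; lra.
Qed.

Theorem lemma2p1 (eps0 mu0 : R) (chi : R -> R) :
  0 < eps0 -> 0 < mu0 -> susceptibility_kernel chi ->
  (strongly_passive eps0 (material eps0 chi) /\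
   bounded_on_half_planes eps0 (material eps0 chi)) /\
  (strongly_passive mu0 (material mu0 chi) /\
   bounded_on_half_planes mu0 (material mu0 chi)).
Proof.
intros He Hm Hchi; split; apply material_susceptibility; assumption.
Qed.
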